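(* Let $n\ge 2$ and let $\mathcal{L}$ be the Laplacian of a strongly connected, weight-balanced directed graph on $[n]$. For any node set $\alpha\subset[n]$ with $|\alpha|\ge 2$, $$(\mathcal{L}^{\dagger}_s)^{\dagger}/\alpha^c=\bigl((\mathcal{L}/\alpha^c)^{\dagger}_s\bigr)^{\dagger}.$$ That is, the operation $\mathcal{L}\mapsto(\mathcal{L}^{\dagger}_s)^{\dagger}$ commutes with Kron reduction $\mathcal{L}\mapsto\mathcal{L}/\alpha^c$.
   Context: A directed graph on $[n]$ has weighted adjacency matrix $\mathcal{A}\ge0$ with zero diagonal; its Laplacian is $\mathcal{L}=\mathcal{D}-\mathcal{A}$ with $\mathcal{D}$ the diagonal matrix of row sums of $\mathcal{A}$. Strongly connected: a directed path exists between every ordered pair of nodes. Weight-balanced: $\mathcal{L}^{\top}\bm{1}=\bm{0}$ (in addition to $\mathcal{L}\bm{1}=\bm{0}$). $\dagger$ denotes the Moore–Penrose pseudoinverse, and for a square matrix $X$ we write $X^{\dagger}_s:=\tfrac12(X^{\dagger}+(X^{\dagger})^{\top})$. For $X\in\mathbb{R}^{n\times n}$ and $\alpha\subset[n]$, $X[\beta,\gamma]$ is the submatrix with rows $\beta$ and columns $\gamma$, $\alpha^c=[n]\setminus\alpha$, and the Schur complement (Kron reduction) is $X/\alpha^c:=X[\alpha,\alpha]-X[\alpha,\alpha^c]X[\alpha^c,\alpha^c]^{-1}X[\alpha^c,\alpha]$ whenever $X[\alpha^c,\alpha^c]$ is invertible (both Schur complements in the claim are well defined; $\mathcal{L}/\alpha^c$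 is again the Laplacian of a strongly connected weight-balanced directed graph on the node set $\alpha$). *)

(* Defs.v *)
From HB Require Import structures.
From mathcomp Require Import all_boot all_order all_algebra.
From mathcomp Require Import reals ring.
Set Implicit Arguments. Unset Strict Implicit. Unset Printing Implicit Defensive.
Import Order.TTheory GRing.Theory Num.Theory.
Local Open Scope ring_scope.

Definition penrose (R : realFieldType) (m n : nat)
    (A : 'M[R]_(m, n)) (X : 'M[R]_(n, m)) : bool :=
  [&& A *m X *m A == A, X *m A *m X == X,
      (A *m X)^T == A *m X & (X *m A)^T == X *m A].

Lemma mulmx_tr_eq0 (R : realFieldType) (n : nat) (v : 'rV[R]_n) :
  v *m v^T = 0 -> v = 0.
Proof.
move=> /matrixP /(_ ord0 ord0); rewrite !mxE.
under eq_bigr do rewrite mxE -expr2.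
move=> v0; apply/rowP => i; rewrite mxE.
by have /eqP := psumr_eq0P (fun j _ => sqr_ge0 (v ord0 j)) v0 (i := i) isT;
  rewrite sqrf_eq0 => /eqP.
Qed.

Lemma gram_unitmx (R : realFieldType) (m n : nat) (B : 'M[R]_(m, n)) :
  row_free B -> B *m B^T \in unitmx.
Proof.
move=> Bf; rewrite -row_free_unit; apply: inj_row_free => v vB0.
have: v *m B *m (v *m B)^T = 0.
  by rewrite trmx_mul !mulmxA -(mulmxA v) vB0 mul0mx.
by move/mulmx_tr_eq0/eqP; rewrite mulmx_free_eq0 // => /eqP.
Qed.

Lemma penrose_exists (R : realFieldType) (m n : nat) (A : 'M[R]_(m, n)) :
  exists X, penrose A X.
Proof.
have [r [C [B [defA Cf Bf]]]] : exists r (C : 'M[R]_(m, r)) (B : 'M[R]_(r, n)),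
    [/\ A = C *m B, row_free C^T & row_free B].
  exists (\rank A), (col_base A), (row_base A); split.
  - by rewrite mulmx_base.
  - by rewrite /row_free mxrank_tr; apply: col_base_full.
  - exact: row_base_free.
have Cu : C^T *m C \in unitmx by rewrite -{2}[C]trmxK; apply: gram_unitmx.
have Bu : B *m B^T \in unitmx by apply: gram_unitmx.
pose X := B^T *m invmx (B *m B^T) *m (invmx (C^T *m C) *m C^T).
have AX : A *m X = C *m invmx (C^T *m C) *m C^T.
  by rewrite defA /X -!mulmxA (mulmxA B) mulKVmx.
have XA : X *m A = B^T *m invmx (B *m B^T) *m B.
  by rewrite defA /X -!mulmxA (mulmxA C^T) mulKmx.
exists X; apply/and4P; split; apply/eqP.
- by rewrite AX defA -!mulmxA (mulmxA C^T) mulKmx.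
- by rewrite XA /X -!mulmxA (mulmxA B B^T) mulKVmx.
- by rewrite AX !trmx_mul trmxK trmx_inv trmx_mul trmxK mulmxA.
- by rewrite XA !trmx_mul trmxK trmx_inv trmx_mul trmxK mulmxA.
Qed.

Definition mpinv (R : realFieldType) (m n : nat) (A : 'M[R]_(m, n)) :
  'M[R]_(n, m) := xchoose (penrose_exists A).

Lemma mpinvP (R : realFieldType) (m n : nat) (A : 'M[R]_(m, n)) :
  penrose A (mpinv A).
Proof. exact: xchooseP. Qed.

Lemma penrose_uniq (R : realFieldType) (m n : nat) (A : 'M[R]_(m, n)) X Y :
  penrose A X -> penrose A Y -> X = Y.
Proof.
move=> /and4P[/eqP x1 /eqP x2 /eqP x3 /eqP x4].
move=> /and4P[/eqP y1 /eqP y2 /eqP y3 /eqP y4].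
have AXY : A *m X = A *m Y.
  by rewrite -x3 -{1}y1 -(mulmxA (A *m Y)) trmx_mul x3 y3 !mulmxA x1.
have XAY : X *m A = Y *m A.
  by rewrite -x4 -{1}y1 -(mulmxA A) mulmxA trmx_mul x4 y4 -!mulmxA (mulmxA A X) x1.
by rewrite -x2 XAY -mulmxA AXY mulmxA y2.
Qed.

Definition mpinv_sym (R : realFieldType) (n : nat) (X : 'M[R]_n) : 'M[R]_n :=
  2^-1 *: (mpinv X + (mpinv X)^T).

(* X[beta, gamma], the nodes of each set being listed in increasing order. *)
Definition subm (R : realFieldType) (n : nat) (X : 'M[R]_n)
    (beta gamma : {set 'I_n}) : 'M[R]_(#|beta|, #|gamma|) :=
  \matrix_(i < #|beta|, j < #|gamma|) X (enum_val i) (enum_val j).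

(* The Schur complement X / alpha^c; alpha is the set of nodes that are kept.
   It is meaningful when subm X (~: alpha) (~: alpha) is invertible. *)
Definition kron (R : realFieldType) (n : nat) (X : 'M[R]_n)
    (alpha : {set 'I_n}) : 'M[R]_#|alpha| :=
  subm X alpha alpha
  - subm X alpha (~: alpha) *m invmx (subm X (~: alpha) (~: alpha))
    *m subm X (~: alpha) alpha.

Definition digraph_adj (R : realFieldType) (n : nat) (A : 'M[R]_n) : Prop :=
  (forall i j, 0 <= A i j) /\ (forall i, A i i = 0).

Definition laplacian (R : realFieldType) (n : nat) (A : 'M[R]_n) : 'M[R]_n :=
  diag_mx (\row_i \sum_j A i j) - A.

Definition strongly_connected (R : realFieldType) (n : nat) (A : 'M[R]_n) :
  Prop := forall i j : 'I_n, connect (fun k l => 0 < A k l) i j.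

Definition weight_balanced (R : realFieldType) (n : nat) (A : 'M[R]_n) : Prop :=
  (laplacian A)^T *m (const_mx 1 : 'cV[R]_n) = 0.

(* The remaining facts show that both Schur complements are well defined, i.e.
   that invmx is only ever applied to an invertible matrix. *)

Definition form_ker1 (R : realFieldType) (n : nat) (M : 'M[R]_n) : Prop :=
  [/\ const_mx 1 *m M = 0 :> 'rV_n, M *m const_mx 1 = 0 :> 'cV_n &
      forall x : 'rV[R]_n, x *m M *m x^T = 0 -> forall i j, x 0 i = x 0 j].

Lemma laplacian_quad (R : realFieldType) (n : nat) (A : 'M[R]_n) (x : 'rV_n) :
  (forall j, \sum_i A i j = \sum_i A j i) ->
  (x *m laplacian A *m x^T) 0 0 *+ 2 =
    \sum_i \sum_j A i j * (x 0 i - x 0 j) ^+ 2.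
Proof.
move=> bal.
have -> : (x *m laplacian A *m x^T) 0 0 =
    \sum_i \sum_j A i j * x 0 i ^+ 2 - \sum_i \sum_j A i j * (x 0 i * x 0 j).
  rewrite /laplacian mulmxBr mulmxBl !mxE; congr (_ - _).
    apply: eq_bigr => i _; rewrite mul_mx_diag !mxE -mulr_suml; ring.
  under eq_bigr do rewrite !mxE mulr_suml.
  rewrite exchange_big; apply: eq_bigr => i _; apply: eq_bigr => j _; ring.
transitivity (\sum_i \sum_j A i j * x 0 i ^+ 2 +
    \sum_i \sum_j A i j * x 0 j ^+ 2
    - (\sum_i \sum_j A i j * (x 0 i * x 0 j)) *+ 2).
  rewrite [X in _ = _ + X - _]exchange_big /=.
  under [X in _ = _ + X - _]eq_bigr do rewrite -mulr_suml bal mulr_suml.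
  ring.
rewrite -sumrMnl -big_split -sumrB; apply: eq_bigr => i _ /=.
rewrite -sumrMnl -big_split -sumrB; apply: eq_bigr => j _ /=; ring.
Qed.

Lemma laplacian_form_ker1 (R : realFieldType) (n : nat) (A : 'M[R]_n) :
  digraph_adj A -> strongly_connected A -> weight_balanced A ->
  form_ker1 (laplacian A).
Proof.
move=> [A0 _] conn wb.
have L1 : laplacian A *m const_mx 1 = 0 :> 'cV_n.
  rewrite /laplacian mulmxBl mul_diag_mx; apply/colP => i; rewrite !mxE mulr1.
  by under [X in _ - X]eq_bigr do rewrite mxE mulr1; rewrite subrr.
have bal j : \sum_i A i j = \sum_i A j i.
  move/colP/(_ j): wb; rewrite /laplacian linearB /= tr_diag_mx mulmxBl.
  rewrite mul_diag_mx !mxE mulr1 => /eqP; rewrite subr_eq0 => /eqP ->.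
  by apply: eq_bigr => i _; rewrite !mxE mulr1.
split=> //; first by rewrite -[_ *m _]trmxK trmx_mul trmx_const wb trmx0.
move=> x x0.
have step k l : 0 < A k l -> x 0 k = x 0 l.
  have nn i j : 0 <= A i j * (x 0 i - x 0 j) ^+ 2.
    by rewrite mulr_ge0 ?sqr_ge0.
  move: (laplacian_quad x bal); rewrite x0 mxE mul0rn => /esym s0 Akl.
  have r0 := psumr_eq0P (fun i _ => sumr_ge0 _ (fun j _ => nn i j)) s0 (i := k) isT.
  have /eqP := psumr_eq0P (fun j _ => nn k j) r0 (i := l) isT.
  by rewrite mulf_eq0 gt_eqF //= sqrf_eq0 subr_eq0 => /eqP.
move=> i j; have /connectP[p pth ->] := conn i j.
by elim: p i pth => //= k p IH i /andP[/step -> /IH].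
Qed.

Lemma form_ker1_mpinv (R : realFieldType) (n : nat) (M : 'M[R]_n) :
  form_ker1 M -> form_ker1 (mpinv M).
Proof.
case: n M => [|n] M [oM Mo gM].
  by split=> [||x _ []//]; [rewrite thinmx0|rewrite flatmx0].
set P := mpinv M.
have /and4P[/eqP p1 /eqP p2 /eqP p3 /eqP p4] : penrose M P := mpinvP M.
pose J : 'M[R]_n.+1 := const_mx n.+1%:R^-1.
have JE (Q : 'M[R]_n.+1) : Q^T = Q -> Q *m const_mx 1 = const_mx 1 :> 'cV_n.+1 ->
    (forall i i' j, Q i j = Q i' j) -> Q = J.
  move=> Qs Q1 Qc; apply/matrixP => i j; rewrite mxE.
  have Qs' k l : Q k l = Q l k by rewrite -{1}Qs mxE.
  have c k : Q i k = Q i j by rewrite Qs' (Qc k j) Qs'.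
  move/colP/(_ i): Q1; rewrite !mxE.
  under eq_bigr do rewrite mxE mulr1 c.
  rewrite sumr_const card_ord => Q1.
  by rewrite -[LHS](mulfK (x := n.+1%:R)) ?pnatr_eq0 // mulr_natr Q1 mul1r.
have half (U V : 'M[R]_n.+1) : (U *m V)^T = U *m V ->
    U *m V *m const_mx 1 = 0 :> 'cV_n.+1 ->
    (forall i i' j, (1%:M - U *m V) i j = (1%:M - U *m V) i' j) ->
    U *m V = 1%:M - J.
  move=> UVs UV1 c; rewrite -[LHS](subKr 1%:M); congr (_ - _); apply: JE => //.
    by rewrite linearB /= trmx1 UVs.
  by rewrite mulmxBl mul1mx UV1 subr0.
have const_col (Q : 'M[R]_n.+1) : M *m Q = 0 -> forall i i' j, Q i j = Q i' j.
  move=> MQ i i' j; have := gM (col j Q)^T _ i i'; rewrite !mxE; apply.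
  by rewrite trmxK -mulmxA colE (mulmxA M) MQ mul0mx mulmx0.
have const_row (Q : 'M[R]_n.+1) : Q *m M = 0 -> forall i j j', Q i j = Q i j'.
  move=> QM i j j'; have := gM (row i Q) _ j j'; rewrite !mxE; apply.
  by rewrite -row_mul QM row0 mul0mx.
have PM : P *m M = 1%:M - J.
  apply: half => //; first by rewrite -mulmxA Mo mulmx0.
  by apply: const_col; rewrite mulmxBr mulmx1 mulmxA p1 subrr.
have MP : M *m P = 1%:M - J.
  apply: half => //.
    by rewrite -p3 -[_ *m _]trmxK trmx_mul trmxK trmx_const mulmxA oM mul0mx trmx0.
  have Qs : (1%:M - M *m P)^T = 1%:M - M *m P by rewrite linearB /= trmx1 p3.
  move=> i i' j; rewrite -Qs mxE [RHS]mxE.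
  by apply: const_row; rewrite mulmxBl mul1mx p1 subrr.
have J1 : (1%:M - J) *m const_mx 1 = 0 :> 'cV_n.+1.
  by rewrite -PM -mulmxA Mo mulmx0.
have oJ : const_mx 1 *m (1%:M - J) = 0 :> 'rV_n.+1.
  by rewrite -MP mulmxA oM mul0mx.
have Po : P *m const_mx 1 = 0 :> 'cV_n.+1.
  by rewrite -p2 -(mulmxA P M P) MP -mulmxA J1 mulmx0.
have oP : const_mx 1 *m P = 0 :> 'rV_n.+1.
  by rewrite -p2 !mulmxA -(mulmxA _ P) PM oJ mul0mx.
split=> // x xPx.
have PJ : (1%:M - J) *m P^T = P^T.
  by rewrite -{2}p2 -mulmxA MP trmx_mul linearB /= trmx1 trmx_const.
have w0 : x *m P *m M *m (x *m P)^T = 0.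
  rewrite trmx_mul -(mulmxA x) PM -mulmxA (mulmxA _ P^T) PJ.
  by rewrite -[RHS]trmx0 -xPx !trmx_mul trmxK mulmxA.
have xP0 : x *m P = 0.
  have := congr1 (mulmx x) Po; rewrite mulmx0 mulmxA => /colP /(_ 0).
  rewrite !mxE; under eq_bigr => k _ do rewrite (gM _ w0 k 0) [const_mx _ _ _]mxE mulr1.
  rewrite sumr_const card_ord => /eqP; rewrite mulrn_eq0 /= => /eqP c0.
  by apply/rowP => k; rewrite (gM _ w0 k 0) c0 mxE.
apply: gM; move: (congr1 (mulmx^~ M) xP0); rewrite mul0mx -mulmxA PM mulmxBr.
rewrite mulmx1 => /eqP; rewrite subr_eq0 => /eqP ->.
have -> : J = const_mx n.+1%:R^-1 *m (const_mx 1 : 'rV_n.+1) :> 'M_n.+1.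
  by apply/matrixP => i j; rewrite !mxE big_ord1 !mxE mulr1.
by rewrite mulmxA -(mulmxA _ _ M) oM mulmx0 mul0mx.
Qed.

Lemma form_ker1_mpinv_sym (R : realFieldType) (n : nat) (M : 'M[R]_n) :
  form_ker1 M -> form_ker1 (mpinv_sym M).
Proof.
move=> /form_ker1_mpinv[oP Po gP]; rewrite /mpinv_sym; set P := mpinv M in oP Po gP *.
split=> [||x xS].
- rewrite -scalemxAr mulmxDr oP add0r -[_ *m _]trmxK trmx_mul trmxK trmx_const Po.
  by rewrite trmx0 scaler0.
- rewrite -scalemxAl mulmxDl Po add0r -[_ *m _]trmxK trmx_mul trmxK trmx_const oP.
  by rewrite trmx0 scaler0.
apply: gP; rewrite -xS -scalemxAr -scalemxAl mulmxDr mulmxDl.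
have -> : x *m P^T *m x^T = x *m P *m x^T.
  by rewrite [LHS]mx11_scalar -tr_scalar_mx -mx11_scalar !trmx_mul !trmxK mulmxA.
by rewrite -mulr2n -scaler_nat scalerA mulVf ?pnatr_eq0 // scale1r.
Qed.

Lemma form_ker1_subm_unitmx (R : realFieldType) (n : nat) (M : 'M[R]_n)
    (alpha : {set 'I_n}) :
  form_ker1 M -> (0 < #|alpha|)%N -> subm M (~: alpha) (~: alpha) \in unitmx.
Proof.
move=> [_ _ gM] /card_gt0P[a aP].
pose E : 'M[R]_(#|~: alpha|, n) := \matrix_(i, j) (enum_val i == j)%:R.
have -> : subm M (~: alpha) (~: alpha) = E *m M *m E^T.
  apply/matrixP => i j; rewrite !mxE (bigD1 (enum_val j)) //= !mxE eqxx mulr1.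
  rewrite (bigD1 (enum_val i)) //= !mxE eqxx mul1r !big1 ?addr0 //.
    by move=> k /negPf kn; rewrite !mxE eq_sym kn mulr0.
  by move=> k /negPf kn; rewrite !mxE eq_sym kn mul0r.
rewrite -row_free_unit; apply: inj_row_free => v v0.
have : v *m E *m M *m (v *m E)^T = 0.
  by rewrite trmx_mul mulmxA -!mulmxA (mulmxA E) (mulmxA _ _ v^T) !mulmxA
    -(mulmxA v) -(mulmxA v) v0 mul0mx.
move/gM => c; apply/rowP => i; rewrite mxE.
have := c (enum_val i) a; rewrite !mxE (bigD1 i) //= !mxE eqxx mulr1 !big1 ?addr0.
- by [].
- move=> k _; rewrite !mxE; case: eqP => [ka|]; last by rewrite mulr0.
  by have := enum_valP k; rewrite ka inE aP.
- move=> k ki; rewrite !mxE (inj_eq enum_val_inj) (negPf ki) ?mulr0 //.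
Qed.

Lemma kron_laplacian_defined (R : realFieldType) (n : nat) (A : 'M[R]_n)
    (alpha : {set 'I_n}) :
  digraph_adj A -> strongly_connected A -> weight_balanced A ->
  (0 < #|alpha|)%N ->
  subm (laplacian A) (~: alpha) (~: alpha) \in unitmx.
Proof.
by move=> *; apply: form_ker1_subm_unitmx => //; apply: laplacian_form_ker1.
Qed.

Lemma kron_mpinv_sym_laplacian_defined (R : realFieldType) (n : nat)
    (A : 'M[R]_n) (alpha : {set 'I_n}) :
  digraph_adj A -> strongly_connected A -> weight_balanced A ->
  (0 < #|alpha|)%N ->
  subm (mpinv (mpinv_sym (laplacian A))) (~: alpha) (~: alpha) \in unitmx.
Proof.
move=> *; apply: form_ker1_subm_unitmx => //; apply: form_ker1_mpinv.
by apply: form_ker1_mpinv_sym; apply: laplacian_form_ker1.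
Qed.

(* Main.v *)
Require Import Defs.
From HB Require Import structures.
From mathcomp Require Import all_boot all_order all_algebra reals.
Local Open Scope ring_scope.

(** Let [E] select the rows in [alpha] and let [C] be the centering projection
    [1 - 11^T/k].  If both kernels of [M] consist of constant vectors and [P]
    is any matrix with [M P M = M], then [C (E P E^T) C] is the Moore-Penrose
    inverse of the Kron reduction of [M]: on pseudoinverses, Kron reduction is
    the linear map [P |-> C E P E^T C].  This map commutes with symmetrization,
    so the theorem follows by applying the fact once to [L] and once to the
    pseudoinverse of [mpinv_sym L], and using that the pseudoinverse is
    involutive. *)

Set Implicit Arguments. Unset Strict Implicit. Unset Printing Implicit Defensive.
Import GRing.Theory Num.Theory.

Section Selection.
Variables (R : realFieldType) (n : nat).
Implicit Types (alpha beta gamma : {set 'I_n}) (M : 'M[R]_n).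

(** Restriction as a matrix factor: submatrices become products, so block computations reduce to
    associativity. *)
Definition selmx alpha : 'M[R]_(#|alpha|, n) := rowsub enum_val 1%:M.

Lemma mul_selmx alpha m (X : 'M[R]_(n, m)) :
  selmx alpha *m X = rowsub enum_val X.
Proof. by rewrite /selmx -rowsubE. Qed.

Lemma mul_tr_selmx alpha m (X : 'M[R]_(m, n)) :
  X *m (selmx alpha)^T = colsub enum_val X.
Proof. by rewrite -[LHS]trmxK trmx_mul trmxK mul_selmx;
  apply/matrixP=> i j; rewrite !mxE. Qed.

Lemma submE M beta gamma : subm M beta gamma = selmx beta *m M *m (selmx gamma)^T.
Proof. by rewrite mul_tr_selmx mul_selmx; apply/matrixP => i j; rewrite !mxE. Qed.

Lemma selmxK alpha : selmx alpha *m (selmx alpha)^T = 1%:M.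
Proof.
by rewrite mul_tr_selmx; apply/matrixP => i j; rewrite !mxE (inj_eq enum_val_inj).
Qed.

Lemma selmxC alpha : selmx alpha *m (selmx (~: alpha))^T = 0.
Proof.
rewrite mul_tr_selmx; apply/matrixP => i j; rewrite !mxE.
case: eqP => // ij; have := enum_valP j.
by rewrite -ij inE (enum_valP i).
Qed.

Lemma selmx_const alpha m (a : R) :
  selmx alpha *m const_mx a = const_mx a :> 'M_(_, m).
Proof. by rewrite mul_selmx; apply/matrixP => i j; rewrite !mxE. Qed.

(** Replaces a block decomposition of the rows: identities are checked on [alpha] and on its
    complement, without reordering the nodes. *)
Lemma selmx_inj alpha m (X Y : 'M[R]_(n, m)) :
  selmx alpha *m X = selmx alpha *m Y ->
  selmx (~: alpha) *m X = selmx (~: alpha) *m Y -> X = Y.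
Proof.
rewrite !mul_selmx => /matrixP eXY /matrixP eXYc; apply/matrixP => i j.
case: (boolP (i \in alpha)) => ia.
  by have := eXY (enum_rank_in ia i) j; rewrite !mxE enum_rankK_in.
have ic : i \in ~: alpha by rewrite inE.
by have := eXYc (enum_rank_in ic i) j; rewrite !mxE enum_rankK_in.
Qed.

Lemma selmxC_tr alpha : selmx (~: alpha) *m (selmx alpha)^T = 0.
Proof. by rewrite -[LHS]trmxK trmx_mul trmxK selmxC trmx0. Qed.

(* Extends a vector on [alpha] to all nodes so that [M] maps the extension to
   a vector vanishing off [alpha]. *)
Definition kron_lift M alpha : 'M[R]_(n, #|alpha|) :=
  (selmx alpha)^T - (selmx (~: alpha))^T
    *m invmx (subm M (~: alpha) (~: alpha)) *m subm M (~: alpha) alpha.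

Lemma selmx_kron_lift M alpha : selmx alpha *m kron_lift M alpha = 1%:M.
Proof. by rewrite /kron_lift mulmxBr selmxK !mulmxA selmxC !mul0mx subr0. Qed.

(** Block elimination: the rows in [alpha] give the Schur complement, and in the other rows the
    inverse cancels, leaving 0. *)
Lemma mul_kron_lift M alpha : subm M (~: alpha) (~: alpha) \in unitmx ->
  M *m kron_lift M alpha = (selmx alpha)^T *m kron M alpha.
Proof.
move=> Mu; apply: (@selmx_inj alpha).
  by rewrite !mulmxA selmxK mul1mx /kron_lift mulmxBr !mulmxA -!submE.
rewrite !mulmxA selmxC_tr mul0mx /kron_lift mulmxBr !mulmxA -!submE.
by rewrite mulmxV // mul1mx subrr.
Qed.

Lemma trmx_subm M beta gamma : (subm M beta gamma)^T = subm M^T gamma beta.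
Proof. by apply/matrixP => i j; rewrite !mxE. Qed.

Lemma trmx_kron M alpha : (kron M alpha)^T = kron M^T alpha.
Proof. by rewrite /kron linearB /= !trmx_mul trmx_inv !trmx_subm mulmxA. Qed.

End Selection.

Section KronPseudoinverse.
Variable R : realFieldType.

Definition centermx k : 'M[R]_k := 1%:M - const_mx k%:R^-1.

Lemma trmx_centermx k : (centermx k)^T = centermx k.
Proof. by rewrite /centermx linearB /= trmx1 trmx_const. Qed.

Lemma centermx_const_col k m (Q : 'M[R]_(k, m)) : (0 < k)%N ->
  (forall i i' j, Q i j = Q i' j) -> centermx k *m Q = 0.
Proof.
move=> k0 Qc; apply/matrixP => i j; rewrite mulmxBl mul1mx !mxE.
under eq_bigr do rewrite mxE (Qc _ i).
rewrite sumr_const card_ord -mulrnAl -mulr_natr mulVf ?mul1r ?subrr //.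
by rewrite pnatr_eq0 -lt0n.
Qed.

Lemma centermx_const k m (a : R) : (0 < k)%N ->
  centermx k *m const_mx a = 0 :> 'M_(_, m).
Proof. by move=> k0; apply: centermx_const_col => // i i' j; rewrite !mxE. Qed.

Lemma mul_centermx k m (X : 'M[R]_(m, k)) :
  X *m const_mx 1 = 0 :> 'cV_m -> X *m centermx k = X.
Proof.
move=> X1; rewrite mulmxBr mulmx1.
have -> : const_mx k%:R^-1 =
    (const_mx 1 : 'cV_k) *m (const_mx k%:R^-1 : 'rV_k) :> 'M[R]_k.
  by apply/matrixP => i j; rewrite mxE [RHS]mxE big_ord1 !mxE mul1r.
by rewrite mulmxA X1 mul0mx subr0.
Qed.

Lemma penrose_sym m n (A : 'M[R]_(m, n)) X : penrose A X -> penrose X A.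
Proof. by case/and4P=> *; apply/and4P. Qed.

Lemma mpinv_eq m n (A : 'M[R]_(m, n)) X : penrose A X -> mpinv A = X.
Proof. exact/penrose_uniq/mpinvP. Qed.

Lemma form_ker1_tr n (M : 'M[R]_n) : form_ker1 M -> form_ker1 M^T.
Proof.
move=> [oM Mo gM]; split=> [||x xMx].
- by rewrite -[LHS]trmxK trmx_mul trmxK trmx_const Mo trmx0.
- by rewrite -[LHS]trmxK trmx_mul trmxK trmx_const oM trmx0.
- by apply: gM; apply: trmx_inj; rewrite !trmx_mul trmxK mulmxA xMx trmx0.
Qed.

(** Each column of [Q] lies in the kernel of [M], so the quadratic form of [M] vanishes on it. *)
Lemma form_ker1_const_col n m (M : 'M[R]_n) (Q : 'M[R]_(n, m)) :
  form_ker1 M -> M *m Q = 0 -> forall i i' j, Q i j = Q i' j.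
Proof.
move=> [_ _ gM] MQ i i' j; have := gM (col j Q)^T _ i i'; rewrite !mxE; apply.
by rewrite trmxK -mulmxA colE (mulmxA M) MQ mul0mx mulmx0.
Qed.

Variables (n : nat) (alpha : {set 'I_n}).
Hypothesis alpha_gt0 : (0 < #|alpha|)%N.

(** With [E] the selection and [K] the reduction, the column sums of [K] vanish: [1^T K = 1^T E^T K
    = 1^T M (kron_lift M alpha) = 0]. *)
Lemma centermx_kron (M : 'M[R]_n) : form_ker1 M ->
  centermx #|alpha| *m kron M alpha = kron M alpha.
Proof.
move=> kM; have Mu := form_ker1_subm_unitmx kM alpha_gt0.
apply: trmx_inj; rewrite trmx_mul trmx_centermx mul_centermx //.
apply: trmx_inj; rewrite trmx_mul trmxK trmx0 -(selmx_const alpha) trmx_mul trmx_const.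
by rewrite -mulmxA -mul_kron_lift // mulmxA; case: kM => -> _ _; rewrite mul0mx.
Qed.

Definition kron_mpinv (P : 'M[R]_n) : 'M[R]_#|alpha| :=
  centermx #|alpha| *m subm P alpha alpha *m centermx #|alpha|.

Lemma kron_mpinv_tr P : (kron_mpinv P)^T = kron_mpinv P^T.
Proof. by rewrite /kron_mpinv !trmx_mul trmx_centermx trmx_subm mulmxA. Qed.

Lemma kron_mpinv_mul (M P : 'M[R]_n) : form_ker1 M -> M *m P *m M = M ->
  kron_mpinv P *m kron M alpha = centermx #|alpha|.
Proof.
move=> kM MPM; have Mu := form_ker1_subm_unitmx kM alpha_gt0.
rewrite /kron_mpinv -mulmxA centermx_kron // submE !mulmxA.
rewrite -(mulmxA _ _ (kron _ _)) -mul_kron_lift //.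
(* [M] kills [1 - P M], whose columns are therefore constant and vanish under centering. Hence [P M]
   acts as the identity here, and [kron_lift] restricts to the identity on [alpha]. *)
have Q0 : centermx #|alpha| *m (selmx R alpha *m (1%:M - P *m M)) = 0.
  apply: centermx_const_col => // i i' j; rewrite mul_selmx mxE [RHS]mxE.
  by apply: (form_ker1_const_col kM); rewrite mulmxBr mulmx1 mulmxA MPM subrr.
move/eqP: Q0; rewrite mulmxBr mulmxBr mulmx1 subr_eq0 !mulmxA => /eqP Q0.
by rewrite -Q0 -mulmxA selmx_kron_lift mulmx1.
Qed.

Lemma penrose_kron (M P : 'M[R]_n) : form_ker1 M -> M *m P *m M = M ->
  penrose (kron M alpha) (kron_mpinv P).
Proof.
move=> kM MPM; have XK := kron_mpinv_mul kM MPM.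
have KX : kron M alpha *m kron_mpinv P = centermx #|alpha|.
  (* The kernel condition, [kron] and [kron_mpinv] are all compatible with transposition, so this is
     the previous product for [M^T] and [P^T]. *)
  apply: trmx_inj; rewrite trmx_mul trmx_kron kron_mpinv_tr trmx_centermx.
  apply: kron_mpinv_mul; first exact: form_ker1_tr.
  by rewrite -!trmx_mul mulmxA MPM.
have CC : centermx #|alpha| *m centermx #|alpha| = centermx #|alpha|.
  by rewrite mul_centermx // centermx_const.
apply/and4P; split; apply/eqP.
- by rewrite KX centermx_kron.
- by rewrite XK /kron_mpinv !mulmxA CC.
- by rewrite KX trmx_centermx.
- by rewrite XK trmx_centermx.
Qed.

(** [kron_mpinv] is linear and commutes with transposition, hence with taking symmetric parts. *)
Lemma mpinv_sym_kron (M : 'M[R]_n) : form_ker1 M ->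
  mpinv_sym (kron M alpha) = kron_mpinv (mpinv_sym M).
Proof.
move=> kM; have /and4P[/eqP MPM _ _ _] := mpinvP M.
rewrite /mpinv_sym (mpinv_eq (penrose_kron kM MPM)) kron_mpinv_tr.
rewrite /kron_mpinv !submE -!(scalemxAl, scalemxAr).
by move: (centermx _) => C; rewrite !(mulmxDl, mulmxDr).
Qed.

End KronPseudoinverse.

Theorem theorem3p3 (R : realType) (n : nat) (A : 'M[R]_n)
    (hn : (2 <= n)%N)
    (hA : digraph_adj A)
    (hsc : strongly_connected A)
    (hwb : weight_balanced A)
    (alpha : {set 'I_n})
    (halpha : (2 <= #|alpha|)%N) :
  kron (mpinv (mpinv_sym (laplacian A))) alpha =
  mpinv (mpinv_sym (kron (laplacian A) alpha)).
Proof.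
have alpha_gt0 := ltnW halpha; have kL := laplacian_form_ker1 hA hsc hwb.
have kS := form_ker1_mpinv (form_ker1_mpinv_sym kL).
(* With [S = mpinv_sym (laplacian A)], it remains to see that [kron (mpinv S) alpha] and
   [kron_mpinv alpha S] are mutual pseudoinverses. This is [penrose_kron] for [M = mpinv S] and
   [P = S], whose condition [M P M = M] is the second Penrose equation of [S]. *)
rewrite mpinv_sym_kron //; apply/esym/mpinv_eq/penrose_sym/penrose_kron => //.
by have /and4P[_ /eqP] := mpinvP (mpinv_sym (laplacian A)).
Qed.
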